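(* Let $H$ be a Hilbert space and let $A$ and $B$ be two unbounded self-adjoint operators in $H$, with domains $D(A)$ and $D(B)$, such that all sums and products formed from $A$ and $B$ in this statement are densely defined. Suppose that $B$ is also invertible, that $AB=BA$, and that $D(AB^{-1})\subset D(B)$. Then $A+B$ is self-adjoint on $D(A)$; that is, $D(A+B)=D(A)$ and $(A+B)^*=A+B$.
   Context: ''Unbounded operator'' means a linear operator defined on a linear subspace $D(A)$ of $H$, not necessarily bounded. For operators $A,B$: the sum $A+B$ has domain $D(A)\cap D(B)$; the product is $(BA)x=B(Ax)$ with domain $D(BA)=\{x\in D(A): Ax\in D(B)\}$. $A\subset B$ means $D(A)\subset D(B)$ and $A$, $B$ coincide on $D(A)$. Equality of operators includes equality of domains; in particular $AB=BA$ means $D(AB)=D(BA)$ and $ABx=BAx$ for all $x$ in this common domain. Standing assumption: all operators, together with any operation (sum, product) involving them or their adjoints, are densely defined; bounded operators are defined on all of $H$. An operator $B$ is invertible if there is an everywhere defined bounded operator, denoted $B^{-1}$, on $H$ with $B^{-1}B\subset BB^{-1}=I$. An operator $A$ is self-adjoint if $A=A^*$ (including equality of domains). *)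

(* Defs.v *)
From HB Require Import structures.
From mathcomp Require Import all_boot all_order all_algebra.
From mathcomp Require Import sesquilinear complex.
From mathcomp Require Import all_classical all_reals all_analysis.

Set Implicit Arguments.
Unset Strict Implicit.
Unset Printing Implicit Defensive.
Import Order.TTheory GRing.Theory Num.Theory.
Import numFieldNormedType.Exports.
Local Open Scope classical_set_scope.
Local Open Scope ring_scope.

(* [real_or_complex R K theta]: the scalar field [K] is [R] or [R[i]], and
   [theta] is its conjugation. *)
Variant real_or_complex (R : realType) :
    forall K : numFieldType, {rmorphism K -> K} -> Prop :=
| RealScalars : @real_or_complex R R idfun
| ComplexScalars : @real_or_complex R R[i] Num.conj.

(* The inner product [dot] is linear in its first argument and
   [theta]-semilinear in its second one; the topology of the library structure
   is the one of its norm, which [dot_norm] ties to [dot]. *)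
Record hilbertSpace (K : numFieldType) (theta : {rmorphism K -> K}) :=
  HilbertSpace {
    carrier :> completeNormedModType K;
    dot : {dot carrier for theta};
    dot_norm : forall x : carrier, dot x x = `|x| ^+ 2 }.

(* [app] is total, but its values outside [dom] carry no meaning: every notion
   below looks at [app] only on [dom]. *)
Record operator (K : numFieldType) (V : lmodType K) := Operator {
  dom : set V;
  app :> V -> V;
  dom0 : dom 0;
  dom_linear : forall (a : K) (x y : V), dom x -> dom y -> dom (a *: x + y);
  app_linear : forall (a : K) (x y : V), dom x -> dom y ->
    app (a *: x + y) = a *: app x + app y }.

#[local] Obligation Tactic := idtac.

Section Algebra.
Variables (K : numFieldType) (V : lmodType K).
Implicit Types A B : operator V.

Definition op_sub A B := dom A `<=` dom B /\ forall x, dom A x -> A x = B x.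

(* Leibniz equality of [operator]s would also compare the values outside the
   domains, hence this extensional equality. *)
Definition op_eq A B := dom A = dom B /\ forall x, dom A x -> A x = B x.

Program Definition op_id : operator V := @Operator K V setT id _ _ _.
Next Obligation. by []. Qed.
Next Obligation. by []. Qed.
Next Obligation. by []. Qed.

Program Definition op_add A B : operator V :=
  @Operator K V (dom A `&` dom B) (fun x => A x + B x) _ _ _.
Next Obligation. by move=> A B; split; exact: dom0. Qed.
Next Obligation.
by move=> A B a x y [Ax Bx] [Ay By]; split; exact: dom_linear.
Qed.
Next Obligation.
by move=> A B a x y [Ax Bx] [Ay By] /=; rewrite !app_linear// scalerDr addrACA.
Qed.

Lemma app0 A : A 0 = 0.
Proof.
have := app_linear 1 (dom0 A) (dom0 A).
rewrite !scale1r addr0 => /eqP.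
by rewrite -subr_eq0 opprD addrA subrr add0r oppr_eq0 => /eqP.
Qed.

(* [op_mul B A] is the product BA: first [A], then [B]. *)
Program Definition op_mul B A : operator V :=
  @Operator K V [set x | dom A x /\ dom B (A x)] (fun x => B (A x)) _ _ _.
Next Obligation.
by move=> B A /=; split; [exact: dom0 | rewrite app0; exact: dom0].
Qed.
Next Obligation.
move=> B A a x y /= [Ax Bx] [Ay By]; split; first exact: dom_linear.
by rewrite app_linear//; exact: dom_linear.
Qed.
Next Obligation.
by move=> B A a x y /= [Ax Bx] [Ay By]; rewrite !app_linear.
Qed.

End Algebra.
Arguments op_id {K V}.

Section Analysis.
Variables (K : numFieldType) (theta : {rmorphism K -> K}).
Variable H : hilbertSpace theta.
Implicit Types A B : operator H.

Definition densely_defined A := dense (dom A).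

Definition everywhere_bounded A :=
  dom A = setT /\ exists M : K, forall x, `|A x| <= M * `|x|.

Definition is_inverse B Binv :=
  [/\ everywhere_bounded Binv,
      op_sub (op_mul Binv B) (op_mul B Binv) &
      op_eq (op_mul B Binv) op_id].

Definition is_adjoint_value A (y z : H) :=
  forall x, dom A x -> dot H (A x) y = dot H x z.

Lemma dotC (x y : H) : dot H x y = theta (dot H y x).
Proof. by have := hermitian_subproof x y => ->; rewrite expr0 mul1r. Qed.

Lemma dotPl (a : K) (x y z : H) :
  dot H (a *: x + y) z = a * dot H x z + dot H y z.
Proof. exact: linearPl. Qed.

Lemma dotPr (a : K) (x y z : H) :
  dot H x (a *: y + z) = theta a * dot H x y + dot H x z.
Proof. exact: linearPr. Qed.

Lemma dotBl (x y z : H) : dot H (x - y) z = dot H x z - dot H y z.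
Proof. exact: linearBl. Qed.

Lemma dotBr (x y z : H) : dot H x (y - z) = dot H x y - dot H x z.
Proof. exact: linearBr. Qed.

Lemma dot0r (x : H) : dot H x 0 = 0.
Proof. exact: linear0r. Qed.

Lemma dense_dot_inj A (z z' : H) : densely_defined A ->
  (forall x, dom A x -> dot H x z = dot H x z') -> z = z'.
Proof.
move=> dA zz'; apply/eqP; rewrite -subr_eq0; apply/negPn/negP => w0.
have : forall x, dom A x -> dot H x (z - z') = 0.
  by move=> x Ax; rewrite dotBr zz'// subrr.
move: (z - z') w0 => w w0 w_orth.
have nw0 : 0 < `|w| by rewrite normr_gt0.
have [|x [wx Ax]] := dA _ _ (ball_open w `|w|).
  by exists w; apply: ballxx; rewrite nw0.
move: wx; rewrite -ball_normE /= => wx.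
have xw : dot H x w = 0 by exact: w_orth.
have wx0 : dot H w x = 0.
  by rewrite dotC xw rmorph0.
have E : `|w - x| ^+ 2 = `|w| ^+ 2 + `|x| ^+ 2.
  by rewrite -!dot_norm dotBl !dotBr xw wx0 subr0 sub0r opprK.
have : `|w - x| ^+ 2 < `|w| ^+ 2 by rewrite ltrXn2r// nnegrE.
by rewrite E -[X in _ < X]addr0 ltrD2l => /lt_geF; rewrite exprn_ge0.
Qed.

Program Definition adjoint A (dA : densely_defined A) : operator H :=
  @Operator K H [set y | exists z, is_adjoint_value A y z]
    (fun y => xget 0 [set z | is_adjoint_value A y z]) _ _ _.
Next Obligation.
by move=> A dA /=; exists 0 => x Ax; rewrite !dot0r.
Qed.
Next Obligation.
move=> A dA a x y /= [z xz] [t yt]; exists (a *: z + t) => u Au.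
by rewrite !dotPr xz// yt.
Qed.
Next Obligation.
move=> A dA a x y /= Dx Dy.
have xgetP u : (exists z, is_adjoint_value A u z) ->
    is_adjoint_value A u (xget 0 [set z | is_adjoint_value A u z]).
  exact: (xgetPex 0).
apply: (dense_dot_inj dA) => u Au.
have Hx := xgetP _ Dx; have Hy := xgetP _ Dy.
have Hxy : exists z, is_adjoint_value A (a *: x + y) z.
  by case: Dx Dy => [z xz] [t yt]; exists (a *: z + t) => v Av; rewrite !dotPr xz// yt.
by rewrite -(xgetP _ Hxy _ Au) !dotPr Hx// Hy.
Qed.

Definition selfadjoint A :=
  exists dA : densely_defined A, op_eq A (adjoint dA).

End Analysis.

(* Main.v *)
Require Import Defs.
From HB Require Import structures.
From mathcomp Require Import all_boot all_order all_algebra.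
From mathcomp Require Import all_classical all_reals all_analysis.
Import numFieldNormedType.Exports.
Local Open Scope classical_set_scope.
Local Open Scope ring_scope.

(** Put S = B^-1; it is everywhere defined and symmetric, and AB = BA makes it
    map D(A) into itself with A S = S A there, so D(A) is contained in D(A S),
    hence in D(B). If (A + B)^* y = z, then for x in D(A)
      <A x, S y> = <A S x, y> = <(A + B) S x, y> - <B S x, y> = <x, S z - y>,
    so S y lies in D(A^* ) = D(A). The domain hypothesis now gives y in D(B),
    and therefore <A x, y> = <x, z - B y> for x in D(A), so y lies in D(A). *)

(** Trades the value chosen by [xget] in [adjoint] for a relation whose witness can be exhibited
    directly; density of the domain makes that witness unique, so the chosen value agrees with
    it. *)
Lemma selfadjointP {K : numFieldType} {theta : {rmorphism K -> K}}
    {H : hilbertSpace theta} {A : operator H} :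
  selfadjoint A <->
  densely_defined A /\
  forall y z, is_adjoint_value A y z <-> dom A y /\ A y = z.
Proof.
split=> [[dA [domE appE]]|[dA AP]].
  split=> // y z; split=> [yz|[Dy <-] x Dx].
    have Dy : dom A y by rewrite domE; exists z.
    split=> //; rewrite appE//; apply: (dense_dot_inj dA) => x Dx.
    by rewrite -(xgetPex 0 (ex_intro _ z yz) x Dx) yz.
  have ex_z : exists z, is_adjoint_value A y z by move: Dy; rewrite domE.
  by rewrite [A y]appE//; exact: (xgetPex 0 ex_z).
exists dA; split.
  apply/seteqP; split=> [y Dy|y [z /AP[]//]].
  by exists (A y); apply/AP.
move=> y Dy; have /AP[_ //] : is_adjoint_value A y (adjoint dA y).
by apply: (xgetPex 0); exists (A y); apply/AP.
Qed.

Lemma selfadjoint_sym {K : numFieldType} {theta : {rmorphism K -> K}}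
    {H : hilbertSpace theta} {A : operator H} {x y : H} :
  selfadjoint A -> dom A x -> dom A y -> dot H (A x) y = dot H x (A y).
Proof. by move=> /selfadjointP[_ AP] Dx Dy; apply: (AP y (A y)).2. Qed.

Lemma dotDl {K : numFieldType} {theta : {rmorphism K -> K}}
    {H : hilbertSpace theta} (x y z : H) :
  dot H (x + y) z = dot H x z + dot H y z.
Proof. exact: linearDl. Qed.

Lemma dotDr {K : numFieldType} {theta : {rmorphism K -> K}}
    {H : hilbertSpace theta} (x y z : H) :
  dot H x (y + z) = dot H x y + dot H x z.
Proof. exact: linearDr. Qed.

Lemma inverseK {K : numFieldType} {theta : {rmorphism K -> K}}
    {H : hilbertSpace theta} {B Binv : operator H} (x : H) :
  is_inverse B Binv -> dom B (Binv x) /\ B (Binv x) = x.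
Proof.
move=> [_ _ [domE appE]].
have Dx : dom (op_mul B Binv) x by rewrite domE.
by split; [case: Dx | exact: appE].
Qed.

(** Symmetry passes from B to S: write y = B S y on the left and x = B S x on the right, then move B
    across. *)
Lemma inverse_sym {K : numFieldType} {theta : {rmorphism K -> K}}
    {H : hilbertSpace theta} {B Binv : operator H} (x y : H) :
  selfadjoint B -> is_inverse B Binv ->
  dot H (Binv x) y = dot H x (Binv y).
Proof.
move=> sB invB; have [DSx BSx] := inverseK x invB.
have [DSy BSy] := inverseK y invB.
by rewrite -[in LHS]BSy -[in RHS]BSx (selfadjoint_sym sB DSx DSy).
Qed.

(** Since B S x = x, the vector S x lies in D(AB) = D(BA), and A x = B A S x. Applying S and
    cancelling S B on D(B) gives the formula. *)
Lemma inverse_commute {K : numFieldType} {theta : {rmorphism K -> K}}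
    {H : hilbertSpace theta} {A B Binv : operator H} {x : H} :
  is_inverse B Binv -> op_eq (op_mul A B) (op_mul B A) ->
  dom A x -> dom A (Binv x) /\ A (Binv x) = Binv (A x).
Proof.
move=> invB [domAB appAB] Dx.
have [DSx BSx] := inverseK x invB.
have DABx : dom (op_mul A B) (Binv x) by split=> //; rewrite BSx.
have [DAx DBAx] : dom (op_mul B A) (Binv x) by rewrite -domAB.
have /= := appAB _ DABx; rewrite BSx => ->.
case: (invB) => -[domS _] [_ SB] _.
have DSBA : dom (op_mul Binv B) (A (Binv x)) by split=> //; rewrite domS.
split=> //; have /= -> := SB _ DSBA.
by rewrite (inverseK _ invB).2.
Qed.

Theorem theorem3 (R : realType) (K : numFieldType) (theta : {rmorphism K -> K})
    (hK : real_or_complex R theta) (H : hilbertSpace theta)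
    (A B Binv : operator H)
    (sA : selfadjoint A) (sB : selfadjoint B)
    (invB : is_inverse B Binv)
    (dAB : densely_defined (op_mul A B))
    (dBA : densely_defined (op_mul B A))
    (dABinv : densely_defined (op_mul A Binv))
    (dAaddB : densely_defined (op_add A B))
    (AB_BA : op_eq (op_mul A B) (op_mul B A))
    (domABinv : dom (op_mul A Binv) `<=` dom B) :
  dom (op_add A B) = dom A /\ selfadjoint (op_add A B).
Proof.
have domS x : dom Binv x by case: invB => -[-> _].
have [_ AP] := selfadjointP.1 sA.
have SA x (Dx : dom A x) := inverse_commute invB AB_BA Dx.
have AsubB : dom A `<=` dom B.
  by move=> x /SA[DSx _]; apply: domABinv; split.
have domD : dom (op_add A B) = dom A by exact/setIidPl.
split=> //; apply/selfadjointP; split=> // y z; split=> [yz|].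
  have DASy : dom A (Binv y).
    (* The candidate for A S y comes from applying S formally to z = A y + B y. *)
    apply: (proj1 ((AP _ (Binv z - y)).1 _)) => x Dx.
    have [DSx ASx] := SA x Dx.
    have [_ BSx] := inverseK x invB.
    (* Testing at S x rather than x turns the B term into <x, y>, which makes sense before y is
       known to lie in D(B). *)
    have : dot H (op_add A B (Binv x)) y = dot H (Binv x) z.
      by apply: yz; rewrite domD.
    rewrite /= dotDl BSx ASx !(inverse_sym _ _ sB invB) dotBr => <-.
    by rewrite GRing.addrK.
  (* S y in D(A) means y in D(A S); once y is in D(B), B can be moved onto y and [yz] tested at x
     itself. *)
  have DBy : dom B y by apply: domABinv; split.
  have [DAy Ay] : dom A y /\ A y = z - B y.
    apply/AP => x Dx.
    have : dot H (op_add A B x) y = dot H x z by apply: yz; rewrite domD.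
    rewrite /= dotDl dotBr => <-.
    by rewrite -(selfadjoint_sym sB (AsubB _ Dx) DBy) GRing.addrK.
  by split; [rewrite domD | rewrite /= Ay GRing.subrK].
(* Conversely, A + B is symmetric because both summands are. *)
move=> [[DAy DBy] <-] x [DAx DBx] /=.
by rewrite dotDl dotDr !selfadjoint_sym.
Qed.
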